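(* Let $\mathcal L$ be an MV-algebra. If $F\subseteq\mathcal L$ is an order filter, then its kernel $\mathcal K(F)$ is an implication filter contained in $F$. If moreover $F$ is a prime filter, then $\mathcal K(F)$ is also prime.
   Context: $\mathcal L$ is an MV-algebra with operations $\oplus,\neg,0,1$; $x\otimes y=\neg(\neg x\oplus\neg y)$, $x\to y=\neg x\oplus y$; the order is $x\le y$ iff $x\to y=1$, with lattice operations $\wedge,\vee$. An order filter is a nonempty upward-closed subset of $\mathcal L$. A lattice filter is an order filter closed under $\wedge$. An implication filter is an order filter closed under $\otimes$ (equivalently, a subset containing $1$ and closed under modus ponens: $x,\,x\to y\in F$ imply $y\in F$). An order filter $F$ is prime if it is proper and $x\vee y\in F$ implies $x\in F$ or $y\in F$; ''prime filter'' means prime lattice filter. The kernel of an order filter $F$ is $\mathcal K(F)=\{z\in\mathcal L \mid \text{for all } a\notin F,\ z\to a\notin F\}$. *)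

(* Defs.v *)
From HB Require Import structures.
From mathcomp Require Import all_boot classical_sets.

Set Implicit Arguments.
Unset Strict Implicit.
Unset Printing Implicit Defensive.

Local Open Scope classical_set_scope.

(* MV-algebras in the standard axiomatization of Cignoli, D'Ottaviano and
   Mundici; the carrier is an arbitrary type, and the trivial algebra (0 = 1)
   is allowed. *)
HB.mixin Record isMVAlgebra T := {
  mvadd : T -> T -> T;
  mvneg : T -> T;
  mv0 : T;
  mvaddA : associative mvadd;
  mvaddC : commutative mvadd;
  mvadd0 : right_id mv0 mvadd;
  mvnegK : involutive mvneg;
  mvaddN0 : forall x, mvadd x (mvneg mv0) = mvneg mv0;
  mv_lukasiewicz : forall x y,
    mvadd (mvneg (mvadd (mvneg x) y)) y = mvadd (mvneg (mvadd (mvneg y) x)) x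
}.

#[short(type="mvAlgebraType")]
HB.structure Definition MVAlgebra := { T of isMVAlgebra T }.

Section Operations.
Variable L : mvAlgebraType.
Implicit Types x y : L.

Definition mv1 : L := mvneg mv0.
Definition mvmul x y : L := mvneg (mvadd (mvneg x) (mvneg y)).
Definition mvimp x y : L := mvadd (mvneg x) y.
Definition mvle x y : Prop := mvimp x y = mv1.
(* These closed formulas are the join and meet of mvle: see mvjoinP, mvmeetP. *)
Definition mvjoin x y : L := mvimp (mvimp x y) y.
Definition mvmeet x y : L := mvmul x (mvimp x y).

End Operations.

Declare Scope mv_scope.
Delimit Scope mv_scope with MV.
Notation "¬ x" := (mvneg x) (at level 35, right associativity) : mv_scope.
Notation "x ⊕ y" := (mvadd x y) (at level 50, left associativity) : mv_scope.
Notation "x ⊗ y" := (mvmul x y) (at level 40, left associativity) : mv_scope.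
Notation "x ⇒ y" := (mvimp x y) (at level 55, right associativity) : mv_scope.
Notation "x ⊑ y" := (mvle x y) (at level 70, no associativity) : mv_scope.
Notation "x ⊔ y" := (mvjoin x y) (at level 50, left associativity) : mv_scope.
Notation "x ⊓ y" := (mvmeet x y) (at level 40, left associativity) : mv_scope.
Local Open Scope mv_scope.

Section Order.
Variable L : mvAlgebraType.
Implicit Types x y z : L.

Lemma mvadd1 x : x ⊕ mv1 L = mv1 L.
Proof. exact: mvaddN0. Qed.

Lemma mvneg1 : ¬ mv1 L = mv0.
Proof. exact: mvnegK. Qed.

Lemma mvle_refl x : x ⊑ x.
Proof.
have := mv_lukasiewicz x (mv1 L).
by rewrite !mvadd1 mvneg1 (mvaddC mv0) mvadd0; exact: esym.
Qed.

Lemma mvjoinC x y : x ⊔ y = y ⊔ x.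
Proof. exact: mv_lukasiewicz. Qed.

Lemma mvjoin_r x y : x ⊑ y -> x ⊔ y = y.
Proof. by rewrite /mvjoin => ->; rewrite /mvimp mvneg1 mvaddC mvadd0. Qed.

Lemma mvle_anti x y : x ⊑ y -> y ⊑ x -> x = y.
Proof. by move=> xy yx; rewrite -(mvjoin_r xy) mvjoinC mvjoin_r. Qed.

Lemma mvle_addl x y : x ⊑ y ⊕ x.
Proof.
have e : ¬ x ⊕ x = mv1 L := mvle_refl x.
by rewrite /mvle /mvimp (mvaddC y) mvaddA e mvaddC mvadd1.
Qed.

Lemma mvle_witness x y : x ⊑ y -> exists z, y = z ⊕ x.
Proof. by move=> /mvjoin_r xy; exists (¬ (y ⇒ x)); rewrite -{1}xy mvjoinC. Qed.

Lemma mvle_trans x y z : x ⊑ y -> y ⊑ z -> x ⊑ z.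
Proof.
move=> /mvle_witness[u ->] /mvle_witness[v ->].
by rewrite mvaddA; exact: mvle_addl.
Qed.

Lemma mvle_neg x y : x ⊑ y -> ¬ y ⊑ ¬ x.
Proof. by rewrite /mvle /mvimp mvnegK mvaddC. Qed.

Lemma mvle_add2r z x y : x ⊑ y -> x ⊕ z ⊑ y ⊕ z.
Proof. by move=> /mvle_witness[u ->]; rewrite -mvaddA; exact: mvle_addl. Qed.

Lemma mvjoinP x y z : x ⊔ y ⊑ z <-> x ⊑ z /\ y ⊑ z.
Proof.
split=> [xyz|[xz yz]].
  split; apply: mvle_trans xyz; last exact: mvle_addl.
  by rewrite mvjoinC; exact: mvle_addl.
rewrite -(mvjoin_r yz) (mvjoinC y z).
by do 2!(apply: mvle_add2r; apply: mvle_neg).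
Qed.

Lemma mvmeetE x y : x ⊓ y = ¬ (¬ x ⊔ ¬ y).
Proof.
rewrite mvjoinC /mvmeet /mvmul /mvjoin /mvimp mvnegK.
by rewrite (mvaddC y) mvaddC.
Qed.

Lemma mvmeetP x y z : z ⊑ x ⊓ y <-> z ⊑ x /\ z ⊑ y.
Proof.
have negE (u v : L) : u ⊑ ¬ v <-> v ⊑ ¬ u.
  by rewrite /mvle /mvimp mvaddC.
have nn (u v : L) : ¬ u ⊑ ¬ v <-> v ⊑ u by rewrite -negE mvnegK.
by rewrite mvmeetE negE mvjoinP !nn.
Qed.

End Order.

Section Filters.
Variable L : mvAlgebraType.
Implicit Type F : set L.

Definition order_filter F : Prop :=
  F !=set0 /\ forall x y, F x -> x ⊑ y -> F y.

Definition lattice_filter F : Prop :=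
  order_filter F /\ forall x y, F x -> F y -> F (x ⊓ y).

Definition implication_filter F : Prop :=
  order_filter F /\ forall x y, F x -> F y -> F (x ⊗ y).

Definition prime_order_filter F : Prop :=
  [/\ order_filter F, F <> setT & forall x y, F (x ⊔ y) -> F x \/ F y].

Definition prime_filter F : Prop := lattice_filter F /\ prime_order_filter F.

Definition kernel F : set L := [set z | forall a, ~ F a -> ~ F (z ⇒ a)].

End Filters.

(* Main.v *)
Require Import Defs.
From HB Require Import structures.
From mathcomp Require Import all_boot classical_sets.
From mathcomp Require Import boolp.

(** Currying, [(x ⊗ y) ⇒ a = x ⇒ (y ⇒ a)], turns closure of the kernel under
    [⊗] into two successive applications of its definition, and antitonicity
    of [⇒] in its first argument makes the kernel upward closed. It lies in [F]
    because an element [z] outside [F] may be tested against itself, and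
    [z ⇒ z = 1] belongs to [F].

    For primeness, suppose that neither [x] nor [y] is in the kernel, as
    witnessed by [a] and [b] outside [F] with [x ⇒ a] and [y ⇒ b] in [F].
    Primeness of [F] keeps the common bound [c = a ⊔ b] outside [F], while
    [x ⇒ c] and [y ⇒ c] are in [F], hence so is their meet, which lies below
    [(x ⊔ y) ⇒ c]. Thus [c] witnesses that [x ⊔ y] is not in the kernel. *)

Local Open Scope classical_set_scope.
Local Open Scope mv_scope.

Lemma mvimp1 (L : mvAlgebraType) (a : L) : mv1 L ⇒ a = a.
Proof. by rewrite /mvimp mvneg1 mvaddC mvadd0. Qed.

Lemma mvimp_curry (L : mvAlgebraType) (x y a : L) :
  x ⊗ y ⇒ a = x ⇒ (y ⇒ a).
Proof. by rewrite /mvimp /mvmul mvnegK mvaddA. Qed.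

Lemma mvle_impl (L : mvAlgebraType) (a x y : L) :
  x ⊑ y -> (y ⇒ a) ⊑ (x ⇒ a).
Proof. by move=> xy; apply: mvle_add2r; apply: mvle_neg. Qed.

Lemma mvle_impr (L : mvAlgebraType) (x a b : L) :
  a ⊑ b -> (x ⇒ a) ⊑ (x ⇒ b).
Proof. by rewrite /mvimp !(mvaddC (¬ x)); apply: mvle_add2r. Qed.

(** The map [_ ⇒ c] is its own adjoint in an order-reversing Galois
    connection, since both inequalities say [¬ x ⊕ ¬ y ⊕ c = 1]. *)
Lemma mvle_imp_swap (L : mvAlgebraType) (x y c : L) :
  x ⊑ (y ⇒ c) -> y ⊑ (x ⇒ c).
Proof. by rewrite /mvle /mvimp mvaddA (mvaddC (¬ x)) -mvaddA. Qed.

(** An instance of the fact that a Galois connection sends joins to meets. *)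
Lemma mvmeet_imp_le (L : mvAlgebraType) (x y c : L) :
  (x ⇒ c) ⊓ (y ⇒ c) ⊑ (x ⊔ y ⇒ c).
Proof.
have [mx my] := (mvmeetP _ _ _).1 (mvle_refl ((x ⇒ c) ⊓ (y ⇒ c))).
by apply: mvle_imp_swap; apply/mvjoinP; split; apply: mvle_imp_swap.
Qed.

Lemma order_filter1 (L : mvAlgebraType) (F : set L) :
  order_filter F -> F (mv1 L).
Proof. by move=> [[x Fx] upF]; apply: (upF x) => //; exact: mvadd1. Qed.

Lemma kernel_implication_filter (L : mvAlgebraType) (F : set L) :
  order_filter F -> implication_filter (kernel F).
Proof.
move=> [_ upF]; split; first split.
- by exists (mv1 L) => a; rewrite mvimp1.
- move=> x y Kx xy a Fa Fya; apply: (Kx a Fa).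
  exact: upF Fya (mvle_impl _ _ _ _ xy).
- by move=> x y Kx Ky a Fa; rewrite mvimp_curry; apply: Kx; apply: Ky.
Qed.

Lemma kernel_sub (L : mvAlgebraType) (F : set L) :
  order_filter F -> kernel F `<=` F.
Proof.
move=> oF z Kz; apply: contrapT => Fz; apply: (Kz z Fz).
by rewrite (mvle_refl z : z ⇒ z = mv1 L); exact: order_filter1.
Qed.

Lemma not_kernel (L : mvAlgebraType) (F : set L) (z : L) :
  ~ kernel F z -> exists2 a, ~ F a & F (z ⇒ a).
Proof.
by move=> Kz; apply: contrapT => noa; apply: Kz => a Fa Fza; apply: noa; exists a.
Qed.

Lemma kernel_prime (L : mvAlgebraType) (F : set L) :
  prime_filter F -> prime_order_filter (kernel F).
Proof.
move=> [[oF meetF] [_ properF primeF]]; have [_ upF] := oF.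
split; first exact: (kernel_implication_filter _ _ oF).1.
  move=> KT; apply: properF; rewrite -subTset -KT; exact: kernel_sub.
move=> x y Kxy; apply: contrapT => /not_orP[/not_kernel[a Fa Fxa]].
move=> /not_kernel[b Fb Fyb].
have [ac bc] := (mvjoinP a b _).1 (mvle_refl (a ⊔ b)).
apply: (Kxy (a ⊔ b)); first by case/primeF.
apply: (upF _ _ _ (mvmeet_imp_le _ _ _ _)); apply: meetF.
- exact: upF Fxa (mvle_impr _ _ _ _ ac).
- exact: upF Fyb (mvle_impr _ _ _ _ bc).
Qed.

Theorem theorem2p1 (L : mvAlgebraType) (F : set L) (hF : order_filter F) :
  (implication_filter (kernel F) /\ kernel F `<=` F) /\
  (prime_filter F -> prime_order_filter (kernel F)).
Proof.
split; last exact: kernel_prime.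
by split; [exact: kernel_implication_filter | exact: kernel_sub].
Qed.
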